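(* Let $\bar{s}=(\bar s_1,\dots,\bar s_n)\in\mathbb{Q}^{n}$ be a probability vector (a candidate signature), with $\bar N=(\bar N_1,\dots,\bar N_n):=n!\,\bar s\in\mathbb{N}^{n}$. For each $l=1,\dots,n$, sort the subsets of $\{1,\dots,n\}$ of cardinality $l$ in lexicographic order, and let $\Omega^{l}$ be the family of the first $$\frac{\bar N_1+\cdots+\bar N_l}{(n-l)!\,l!}=(\bar{s}_{1}+\cdots+\bar{s}_{l})\binom{n}{l}$$ of these subsets. The family $\Omega^{l+1}$ should contain all the subsets of $\{1,\dots,n\}$ of cardinality $l+1$ that are supersets of at least one element of $\Omega^{l}$ (for each $1\le l\le n-1$). If this is not the case, then $\bar s$ cannot be the signature of a system, since $\bigcup_{l}\Omega^{l}$ is not a simplicial complex.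
   Context: Let $X=\{1,\dots,n\}$ be the set of components. A system is given by its structure function, that is, a function $\phi:2^{X}\to\{0,1\}$ that is non-decreasing ($A\subseteq B$ implies $\phi(A)\le\phi(B)$) with $\phi(\emptyset)=0$ and $\phi(X)=1$; $\phi(G)=1$ means that the system is up when $G$ is the set of working components. Signature: for a permutation $\sigma$ of $\{1,\dots,n\}$ (the order in which components fail) there is exactly one index $i\in\{1,\dots,n\}$, the breakdown index of $\sigma$, such that $\phi(\{\sigma(i),\dots,\sigma(n)\})=1$ and $\phi(\{\sigma(i+1),\dots,\sigma(n)\})=0$ (the latter set is empty for $i=n$). Let $N_i(\phi)$ be the number of permutations with breakdown index $i$. The signature of the system is the probability vector $s(\phi)=\frac{1}{n!}(N_1(\phi),\dots,N_n(\phi))$. A vector $\bar s$ is the signature of a system if $\bar s=s(\phi)$ for some structure function $\phi$ on $X$. Lexicographic order: each subset of $\{1,\dots,n\}$ of cardinality $l$ is written as the string of its elements in increasing order, and strings are compared lexicographically (for $n=5$, $l=2$ the order begins $\{1,2\},\{1,3\},\{1,4\},\{1,5\},\{2,3\},\dots$). A simplicial complex here is a family of subsets closed under passing to (nonempty) subsets. *)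

(* Defs.v *)
From HB Require Import structures.
From mathcomp Require Import all_boot all_order all_algebra all_fingroup.

Set Implicit Arguments.
Unset Strict Implicit.
Unset Printing Implicit Defensive.

Import Order.TTheory GRing.Theory Num.Theory.

(* The components 1, ..., n are the ordinals 0, ..., n.-1 of
   'I_n, and the breakdown index i in {1, ..., n} is likewise shifted by one. *)

Definition structure_function (n : nat) (phi : {set 'I_n} -> bool) : Prop :=
  [/\ forall A B : {set 'I_n}, A \subset B -> (phi A <= phi B)%N,
      phi set0 = false
    & phi setT = true].

(* The components fail in the order sigma 0, sigma 1, ... *)
Definition breakdown_index (n : nat) (phi : {set 'I_n} -> bool)
    (sigma : 'S_n) (i : 'I_n) : bool :=
  phi [set sigma j | j in 'I_n & (i <= j)%N]
  && ~~ phi [set sigma j | j in 'I_n & (i < j)%N].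

Definition breakdown_count (n : nat) (phi : {set 'I_n} -> bool) (i : 'I_n)
    : nat :=
  #|[set sigma : 'S_n | breakdown_index phi sigma i]|.

Definition signature (n : nat) (phi : {set 'I_n} -> bool) : 'rV[rat]_n :=
  (\row_i ((breakdown_count phi i)%:R / (n`!)%:R))%R.

Definition is_signature (n : nat) (s : 'rV[rat]_n) : Prop :=
  exists2 phi : {set 'I_n} -> bool, structure_function phi & s = signature phi.

Definition probability_vector (n : nat) (s : 'rV[rat]_n) : Prop :=
  ((forall i, 0 <= s 0 i) /\ \sum_i s 0 i = 1)%R.

(* [enum] lists the elements of a subset of 'I_n in increasing order. *)
Definition string_of_set (n : nat) (A : {set 'I_n}) : seqlexi nat :=
  [seq val i | i <- enum A].

Definition lex_le (n : nat) : rel {set 'I_n} :=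
  fun A B => (string_of_set A <= string_of_set B)%O.

Definition lex_subsets (n l : nat) : seq {set 'I_n} :=
  sort (@lex_le n) (enum [set A : {set 'I_n} | #|A| == l]).

(* The quotient (N_1 + ... + N_l) / ((n - l)! l!); it is an integer whenever N
   comes from a signature, and is rounded down otherwise. *)
Definition omega_size (n : nat) (N : 'rV[nat]_n) (l : nat) : nat :=
  (\sum_(i < n | (i < l)%N) N ord0 i) %/ ((n - l)`! * l`!).

Definition Omega (n : nat) (N : 'rV[nat]_n) (l : nat) : {set {set 'I_n}} :=
  [set A in take (omega_size N l) (lex_subsets n l)].

Definition OmegaU (n : nat) (N : 'rV[nat]_n) : {set {set 'I_n}} :=
  \bigcup_(1 <= l < n.+1) Omega N l.

Definition contains_supersets (n : nat) (N : 'rV[nat]_n) : Prop :=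
  forall l : nat, (1 <= l <= n.-1)%N ->
  forall A B : {set 'I_n},
    A \in Omega N l -> A \subset B -> #|B| = l.+1 -> B \in Omega N l.+1.

Definition simplicial_complex (n : nat) (D : {set {set 'I_n}}) : Prop :=
  forall A B : {set 'I_n},
    A \in D -> B \subset A -> B != set0 -> B \in D.

(* The members of Omega play the role of the sets of failed components for
   which the system is down; their complements are then the sets G of working
   components with phi G = false, and it is this family that is closed under
   subsets when Omega comes from a system. *)
Definition complements (n : nat) (D : {set {set 'I_n}}) : {set {set 'I_n}} :=
  [set ~: A | A in D].

(* Main.v *)
Require Import Defs.
From mathcomp Require Import all_boot all_order all_algebra all_fingroup.
From mathcomp Require Import zify.

(* If the signature of phi is s, the number of sigma with breakdown index at most
   l is l! (n - l)! times the number of l-sets A with phi (~: A) = false, so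
   Omega^l has the same size as the family F_l of these sets. By monotonicity
   every (l+1)-superset of a member of F_l lies in F_(l+1). The Kruskal-Katona
   theorem, in its version for upper shadows and the lexicographic order, says
   that the upper shadow of Omega^l is at most as large as that of F_l, hence at
   most as large as Omega^(l+1); both being initial segments, the former is
   contained in the latter.
   Kruskal-Katona is proved by compression: among the families of the given size
   with at most the given upper shadow, one that is lexicographically earliest
   in total has only initial sections at every point (by induction on the ground
   set), and the only possible defect left is a pair of complementary sets, which
   can be exchanged.
   For the simplicial complexes it suffices that Omega^n = {setT}. *)

Set Implicit Arguments.
Unset Strict Implicit.
Unset Printing Implicit Defensive.

Import Order.TTheory GRing.Theory Num.Theory.

(** * Binary weights of sets and initial segments *)

Lemma sum_pow2_gt n i : i < n -> \sum_(j < n | i < j) 2 ^ (n - j) < 2 ^ (n - i).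
Proof.
(* The exponents only go down to 1, so the sum falls short of [2 ^ (n - i)] by 2; with this 2 added,
   the bound passes from [n] to [n.+1] by doubling. *)
move=> lt_in; apply: (@leq_trans ((\sum_(j < n | i < j) 2 ^ (n - j)) + 2)).
  by rewrite addn2.
elim: n i lt_in => // n IHn i; rewrite ltnS leq_eqVlt big_mkcond big_ord_recr /=.
have double j : j <= n -> 2 ^ (n.+1 - j) = 2 * 2 ^ (n - j).
  by move=> lejn; rewrite subSn // expnS.
case/predU1P=> [->|lt_in].
  rewrite ltnn subSnn big1 // => j _.
  by rewrite ifF // ltnNge ltnW.
rewrite lt_in subSnn double ?(ltnW lt_in) //.
have := IHn i lt_in; rewrite -(leq_pmul2l (isT : 0 < 2)) mulnDr big_distrr /=.
rewrite [X in X + _]big_mkcond /= => /(leq_trans _)-> //.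
rewrite -addnA leq_add2r leq_sum // => j _.
by case: ifP => // _; rewrite double // ltnW.
Qed.

Section Weight.
Variable n : nat.
Implicit Types (A B C S : {set 'I_n}) (F G L U : {set {set 'I_n}}).

(* Among sets of the same size, a larger weight means lexicographically earlier. *)
Definition weight A : nat := \sum_(i in A) 2 ^ (n - i).

(** Below [i] both sets contribute equally, and the single term [2 ^ (n - i)] outweighs everything
    above [i]. *)
Lemma weight_lt_first_diff A B (i : 'I_n) :
    i \notin A -> i \in B ->
    (forall j : 'I_n, j < i -> (j \in A) = (j \in B)) ->
  weight A < weight B.
Proof.
move=> iA iB eqAB; rewrite /weight.
rewrite (bigID (fun j : 'I_n => j < i)) /= [ltnRHS](bigID (fun j : 'I_n => j < i)) /=.
have -> : \sum_(j in A | j < i) 2 ^ (n - j) = \sum_(j in B | j < i) 2 ^ (n - j).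
  apply: eq_bigl => j.
  by case: (ltnP j i) => ji; rewrite ?andbF // (eqAB _ ji).
rewrite ltn_add2l (leq_ltn_trans (n := \sum_(j < n | i < j) 2 ^ (n - j))) //.
  rewrite big_mkcond [leqRHS]big_mkcond leq_sum //= => j _.
  case: (ltngtP j i) => [||/val_inj ->]; rewrite ?andbF ?andbT //=.
    by case: (j \in A).
  by rewrite (negPf iA).
rewrite (leq_trans (sum_pow2_gt (ltn_ord i))) //.
by rewrite (bigD1 i) ?leq_addr //= iB ltnn.
Qed.

Lemma first_diff A B : A != B ->
  exists2 i : 'I_n, (i \in A) != (i \in B) &
    forall j : 'I_n, j < i -> (j \in A) = (j \in B).
Proof.
move=> neqAB.
have /existsP[i0 Pi0] : [exists i, (i \in A) != (i \in B)].
  apply: contraR neqAB => /existsPn h; apply/eqP/setP=> i.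
  by apply/eqP; have := h i; rewrite negbK.
case: (arg_minnP (P := fun i => (i \in A) != (i \in B)) (@nat_of_ord n) Pi0).
move=> i Pi mini; exists i => // j ji; apply/eqP; apply: contraTT ji => h.
by rewrite -leqNgt mini.
Qed.

Lemma weight_inj : injective weight.
Proof.
move=> A B eqw; apply/eqP; apply/negPn/negP => /first_diff[i neq eqlt].
case iA: (i \in A) neq => /=; case iB: (i \in B) => // _.
  by have := weight_lt_first_diff (negbT iB) iA (fun j h => esym (eqlt j h));
    rewrite eqw ltnn.
by have := weight_lt_first_diff (negbT iA) iB eqlt; rewrite eqw ltnn.
Qed.

Lemma weight_ltP A B :
  reflect (exists i : 'I_n, [/\ i \notin A, i \in B &
             forall j : 'I_n, j < i -> (j \in A) = (j \in B)])
          (weight A < weight B).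
Proof.
apply: (iffP idP) => [ltAB|[i []]]; last exact: weight_lt_first_diff.
have /first_diff[i neq eqlt] : A != B by apply: contraTneq ltAB => ->; rewrite ltnn.
exists i; case iA: (i \in A) neq => /=; case iB: (i \in B) => // _.
have := weight_lt_first_diff (negbT iB) iA (fun j h => esym (eqlt j h)).
by rewrite ltnNge (ltnW ltAB).
Qed.

Lemma weightU1 i A : i \notin A -> weight (i |: A) = 2 ^ (n - i) + weight A.
Proof. by move=> iA; rewrite /weight big_setU1. Qed.

Lemma weightD1 i A : i \in A -> weight A = 2 ^ (n - i) + weight (A :\ i).
Proof. by move=> iA; rewrite /weight (big_setD1 i). Qed.

(** Upward closed for [weight] inside [U]; when [U] is a layer, these are the lexicographic initial
    segments. *)
Definition initial U L :=
  L \subset U /\ forall A B, A \in L -> B \in U -> weight A <= weight B -> B \in L.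

Lemma initial_total U L1 L2 : initial U L1 -> initial U L2 ->
  (L1 \subset L2) || (L2 \subset L1).
Proof.
move=> [sL1 iL1] [sL2 iL2]; case: (boolP (L1 \subset L2)) => //=.
case/subsetPn=> A A1 A2; apply/subsetP=> B B2.
case: (leqP (weight A) (weight B)) => [le|/ltnW le].
  by apply: iL1 A1 _ le; apply: (subsetP sL2).
by rewrite (iL2 B A) ?(subsetP sL1) in A2.
Qed.

Lemma initial_sub_card U L1 L2 : initial U L1 -> initial U L2 ->
  #|L1| <= #|L2| -> L1 \subset L2.
Proof.
move=> i1 i2 le; case/orP: (initial_total i1 i2) => // s21.
by have /eqP-> : L2 == L1 by rewrite eqEcard s21.
Qed.

Lemma initial_exists U m : m <= #|U| -> exists2 L, initial U L & #|L| = m.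
Proof.
elim: m => [|m IHm] lem.
  by exists set0; rewrite ?cards0 //; split=> [|A B]; rewrite ?sub0set ?inE.
have [L [sL iL] cL] := IHm (ltnW lem).
have [A0 A0U] : exists A, A \in U :\: L.
  apply/set0Pn; apply: contraTneq lem => /eqP; rewrite setD_eq0 -leqNgt -cL.
  exact: subset_leq_card.
(* The segment grows by the heaviest set still outside it. *)
case: (arg_maxnP (P := fun A => A \in U :\: L) weight A0U) => A AUL maxA.
have /setDP[AU AL] := AUL.
exists (A |: L); last by rewrite cardsU1 AL cL.
split; first by rewrite subUset sub1set AU.
move=> B C /setU1P[->|BL] CU le.
  have [CL|CL] := boolP (C \in L); first by rewrite inE CL orbT.
  have leC : weight C <= weight A by apply: maxA; rewrite inE CU CL.
  suff -> : C = A by rewrite setU11.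
  by apply: weight_inj; apply/eqP; rewrite eqn_leq le leC.
by rewrite inE (iL _ _ BL CU le) orbT.
Qed.

Definition total_weight F := \sum_(A in F) weight A.

(** The differences [F :\: L] and [L :\: F] have the same positive size, and every set in the second
    is heavier than every set in the first. *)
Lemma initial_total_weight U F L : F \subset U -> initial U L -> #|F| = #|L| ->
  F != L -> total_weight F < total_weight L.
Proof.
move=> sF [sL iL] cFL neq.
have neqD : F :\: L != set0.
  apply: contraNneq neq => /eqP; rewrite setD_eq0 => sFL.
  by rewrite eqEcard sFL cFL leqnn.
case/set0Pn: neqD => A0 A0P.
case: (arg_maxnP (P := fun A => A \in F :\: L) weight A0P) => A AP maxA.
have cD : #|F :\: L| = #|L :\: F|.
  have := cardsID L F; have := cardsID F L; rewrite setIC; lia.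
rewrite /total_weight (big_setID L) /= [ltnRHS](big_setID F) /= setIC ltn_add2l.
apply: (@leq_ltn_trans (#|F :\: L| * weight A)).
  by rewrite -sum_nat_const leq_sum.
apply: (@leq_trans (#|F :\: L| * (weight A).+1)).
  by rewrite ltn_pmul2l //; apply/card_gt0P; exists A0.
rewrite cD -sum_nat_const leq_sum // => B /setDP[BL BF].
case/setDP: AP => AF AL; rewrite ltnNge; apply: contra AL => le.
by apply: iL BL _ le; apply: (subsetP sF).
Qed.

End Weight.

(** * Upper shadows and the Kruskal-Katona theorem *)

Section KruskalKatona.
Variable n : nat.
Implicit Types (A B C S : {set 'I_n}) (F G L U : {set {set 'I_n}}) (i : 'I_n).

Definition layer S k : {set {set 'I_n}} := [set A : {set 'I_n} | (A \subset S) && (#|A| == k)].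

Definition up_shadow S F : {set {set 'I_n}} :=
  [set B : {set 'I_n} | (B \subset S) && [exists x, (x \in B) && (B :\ x \in F)]].

Lemma layerP S k A : reflect (A \subset S /\ #|A| = k) (A \in layer S k).
Proof. by rewrite inE; apply: (iffP andP) => -[sAS /eqP]. Qed.

Lemma up_shadowP S F B :
  reflect (B \subset S /\ exists2 x, x \in B & B :\ x \in F) (B \in up_shadow S F).
Proof.
rewrite inE; apply: (iffP andP) => -[sBS].
  by case/existsP=> x /andP[xB xF]; split=> //; exists x.
by case=> x xB xF; split=> //; apply/existsP; exists x; rewrite xB.
Qed.

Lemma up_shadow_layer S k F : F \subset layer S k ->
  up_shadow S F \subset layer S k.+1.
Proof.
move=> /subsetP sF; apply/subsetP=> B /up_shadowP[sBS [x xB /sF/layerP[_ cB]]].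
by apply/layerP; split; rewrite // (cardsD1 x) xB cB.
Qed.

Lemma max_elt A : A != set0 -> exists2 a, a \in A & forall x, x \in A -> x <= a.
Proof.
case/set0Pn=> a0 a0A.
by case: (arg_maxnP (P := mem A) (@nat_of_ord n) a0A) => a aA maxa; exists a.
Qed.

(* Removing the largest element costs the least weight, and it is monotone for
   the lexicographic order. *)
Lemma initial_up_shadow S k L :
  initial (layer S k) L -> initial (layer S k.+1) (up_shadow S L).
Proof.
move=> [sL iL]; split; first exact: up_shadow_layer.
move=> B C Bsh /layerP[sCS cC] leBC.
have /layerP[sBS cB] := subsetP (up_shadow_layer sL) _ Bsh.
have [-> //|neqBC] := eqVneq C B.
have [i [iB iC eqlt]] : exists i : 'I_n, [/\ i \notin B, i \in C &
    forall j : 'I_n, j < i -> (j \in B) = (j \in C)].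
  apply/weight_ltP; rewrite ltn_neqAle leBC andbT.
  by apply: contraNneq neqBC => /weight_inj->.
have [|b bB maxb] := @max_elt B; first by rewrite -card_gt0 cB.
have [|c cC' maxc] := @max_elt C; first by rewrite -card_gt0 cC.
case/up_shadowP: Bsh => _ [x xB xL].
have cBb : #|B :\ b| = k by have := cardsD1 b B; rewrite bB cB => -[].
have cCc : #|C :\ c| = k by have := cardsD1 c C; rewrite cC' cC => -[].
(* Some [B :\ x] is in [L], and [B :\ b] is at least as heavy because the largest element has the
   smallest weight. *)
have BbL : B :\ b \in L.
  apply: iL xL _ _; first by apply/layerP; rewrite (subset_trans (subD1set _ _)).
  have := weightD1 xB; rewrite (weightD1 bB).
  by have : 2 ^ (n - b) <= 2 ^ (n - x); [rewrite leq_exp2l // leq_sub2l ?maxb | lia].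
apply/up_shadowP; split=> //; exists c => //.
apply: iL BbL _ _; first by apply/layerP; rewrite (subset_trans (subD1set _ _)).
(* Otherwise [B] would lie entirely before [i], hence inside [C :\ i], which has one element fewer
   than [B]. *)
have ltib : i < b.
  rewrite ltnNge; apply/negP=> lebi.
  have sub : B \subset C :\ i.
    apply/subsetP=> y yB; have neqyi : y != i by apply: contraTneq yB => ->.
    have ltyi : y < i by rewrite ltn_neqAle neqyi (leq_trans (maxb _ yB)).
    by rewrite !inE neqyi -eqlt.
  by have := subset_leq_card sub; have := cardsD1 i C; rewrite iC cC cB add1n => -[<-]; rewrite ltnn.
(* If the first difference [i] is the last element of [C], the two truncated sets coincide;
   otherwise [i] remains their first difference. *)
have [eqic|neqic] := eqVneq i c.
  suff -> : B :\ b = C :\ c by [].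
  apply/esym/eqP; rewrite eqEcard cBb cCc leqnn andbT; apply/subsetP=> y.
  case/setD1P=> neqyc yC.
  have ltyi : y < i by rewrite eqic ltn_neqAle neqyc maxc.
  rewrite !inE eqlt // yC andbT; apply: contraTneq ltyi => ->.
  by rewrite -leqNgt ltnW.
have ltic : i < c by rewrite ltn_neqAle neqic maxc.
apply/ltnW/weight_ltP; exists i; split.
- by rewrite !inE negb_and iB orbT.
- by rewrite !inE neqic.
move=> j ltji; rewrite !inE eqlt //; congr (_ && _).
have /negPf -> : j != b by apply: contraTneq ltji => ->; rewrite -leqNgt ltnW.
by have /negPf -> : j != c by apply: contraTneq ltji => ->; rewrite -leqNgt ltnW.
Qed.

(** * Splitting a family at a point *)

Definition deletion i F : {set {set 'I_n}} := [set A in F | i \notin A].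
Definition link i F : {set {set 'I_n}} := [set A : {set 'I_n} | (i \notin A) && (i |: A \in F)].
(** Inverse of the splitting into [deletion] and [link]; compression at [i] glues initial segments
    of the same sizes as the two sections. *)
Definition glue i F0 F1 : {set {set 'I_n}} := F0 :|: [set i |: A | A in F1].

Lemma setU1_inj i : {in [pred A : {set 'I_n} | i \notin A] &, injective (fun A => i |: A)}.
Proof. by move=> A B iA iB /(congr1 (fun C => C :\ i)); rewrite !setU1K. Qed.

Lemma mem_setU1_imset i F A : A \in [set i |: A | A in F] -> i \in A.
Proof. by case/imsetP=> B _ ->; rewrite setU11. Qed.

Lemma linkE i F : [set A in F | i \in A] = [set i |: A | A in link i F].
Proof.
apply/setP=> A; apply/idP/imsetP => [|[B + ->]]; rewrite !inE.
  by case/andP=> AF iA; exists (A :\ i); rewrite ?inE ?eqxx /= ?setD1K.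
by case/andP=> _ ->; rewrite eqxx.
Qed.

Lemma big_deletion_link i F (f : {set 'I_n} -> nat) :
  \sum_(A in F) f A = \sum_(A in deletion i F) f A + \sum_(A in link i F) f (i |: A).
Proof.
rewrite (bigID (fun A : {set 'I_n} => i \notin A)) /=; congr (_ + _).
  by apply: eq_bigl => A; rewrite inE.
transitivity (\sum_(A in [set A in F | i \in A]) f A).
  by apply: eq_bigl => A; rewrite inE negbK.
rewrite linkE big_imset //= => A B; rewrite !inE => /andP[iA _] /andP[iB _].
by apply: setU1_inj.
Qed.

Lemma card_deletion_link i F : #|F| = #|deletion i F| + #|link i F|.
Proof. by rewrite -!sum1_card (big_deletion_link i). Qed.

Lemma total_weight_deletion_link i F : total_weight F =
  total_weight (deletion i F) + total_weight (link i F) + #|link i F| * 2 ^ (n - i).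
Proof.
rewrite /total_weight (big_deletion_link i) -addnA; congr (_ + _).
rewrite addnC -sum_nat_const -big_split; apply: eq_bigr => A.
by rewrite inE => /andP[iA _]; rewrite weightU1.
Qed.

Lemma deletion_layer i S k F : F \subset layer S k ->
  deletion i F \subset layer (S :\ i) k.
Proof.
move=> /subsetP sF; apply/subsetP=> A; rewrite inE => /andP[/sF/layerP[sAS cA] iA].
by apply/layerP; rewrite subsetD1 sAS.
Qed.

Lemma link_layer i S k F : F \subset layer S k.+1 ->
  link i F \subset layer (S :\ i) k.
Proof.
move=> /subsetP sF; apply/subsetP=> A; rewrite inE => /andP[iA /sF/layerP[sAS cA]].
apply/layerP; rewrite subsetD1 iA (subset_trans (subsetUr _ _) sAS); split=> //.
by move: cA; rewrite cardsU1 iA => -[].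
Qed.

Lemma glue_layer i S k F0 F1 : i \in S ->
  F0 \subset layer (S :\ i) k.+1 -> F1 \subset layer (S :\ i) k ->
  glue i F0 F1 \subset layer S k.+1.
Proof.
move=> iS /subsetP s0 /subsetP s1; apply/subsetP=> A /setUP[/s0|/imsetP[B /s1 + ->]].
  by case/layerP; rewrite subsetD1 => /andP[sAS _] cA; apply/layerP.
case/layerP; rewrite subsetD1 => /andP[sBS iB] cB; apply/layerP.
by rewrite subUset sub1set iS cardsU1 iB cB.
Qed.

Lemma deletion_glue i S k F0 F1 : F0 \subset layer (S :\ i) k ->
  deletion i (glue i F0 F1) = F0.
Proof.
move=> /subsetP s0; apply/setP=> A; rewrite !inE.
have [A0|] /= := boolP (A \in F0).
  by case/s0/layerP: A0; rewrite subsetD1 => /andP[].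
by move=> _; apply/andP=> -[/mem_setU1_imset->].
Qed.

Lemma link_glue i S k l F0 F1 :
    F0 \subset layer (S :\ i) k -> F1 \subset layer (S :\ i) l ->
  link i (glue i F0 F1) = F1.
Proof.
move=> /subsetP s0 /subsetP s1; apply/setP=> A; rewrite !inE.
apply/andP/idP => [[iA /orP[]]|A1].
- by case/s0/layerP; rewrite subsetD1 setU11 andbF.
- case/imsetP=> B B1 eqAB; suff -> : A = B by [].
  apply: (@setU1_inj i) eqAB; rewrite !inE //.
  by case/s1/layerP: B1; rewrite subsetD1 => /andP[].
split; first by case/s1/layerP: A1; rewrite subsetD1 => /andP[].
by rewrite imset_f ?orbT.
Qed.

Lemma deletion_up_shadow i S F :
  deletion i (up_shadow S F) = up_shadow (S :\ i) (deletion i F).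
Proof.
apply/setP=> B; rewrite inE; apply/andP/up_shadowP.
  case=> /up_shadowP[sBS [x xB BF]] iB; rewrite subsetD1 sBS; split=> //.
  by exists x => //; rewrite !inE BF negb_and iB orbT.
rewrite subsetD1 => -[/andP[sBS iB] [x xB]]; rewrite inE => /andP[BF _].
by split=> //; apply/up_shadowP; split=> //; exists x.
Qed.

(** From [i |: B] one removes either an element of [B], which leaves a member containing [i], or [i]
    itself, which leaves [B]. *)
Lemma link_up_shadow i S k F : i \in S -> F \subset layer S k ->
  link i (up_shadow S F) = up_shadow (S :\ i) (link i F) :|: deletion i F.
Proof.
move=> iS /subsetP sF; apply/setP=> B; rewrite !inE -/(layer _ _).
apply/andP/orP.
  case=> iB /andP[]; rewrite subUset => /andP[_ sBS] /existsP[x /andP[]].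
  case/setU1P=> [->|xB]; first by rewrite setU1K // => BF; right; rewrite BF.
  have neqix : i != x by apply: contraNneq iB => ->.
  move=> BF; left; rewrite subsetD1 sBS iB; apply/existsP; exists x.
  rewrite xB !inE (negPf iB) andbF /=; suff <- : (i |: B) :\ x = i |: B :\ x by [].
  by rewrite setDUl; congr (_ :|: _); apply/setDidPl; rewrite disjoints1 inE.
case=> [/andP[]|/andP[BF iB]].
  rewrite subsetD1 => /andP[sBS iB] /existsP[x /andP[xB]].
  rewrite inE => /andP[_ BF]; split=> //; rewrite subUset sub1set iS sBS /=.
  have neqix : i != x by apply: contraNneq iB => ->.
  apply/existsP; exists x; rewrite inE xB orbT /=.
  suff -> : (i |: B) :\ x = i |: B :\ x by [].
  by rewrite setDUl; congr (_ :|: _); apply/setDidPl; rewrite disjoints1 inE.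
split=> //; rewrite subUset sub1set iS /=.
have /layerP[-> _] := sF _ BF.
by apply/existsP; exists i; rewrite setU11 setU1K.
Qed.

Lemma card_up_shadow i S k F : i \in S -> F \subset layer S k ->
  #|up_shadow S F| = #|up_shadow (S :\ i) (deletion i F)| +
                     #|up_shadow (S :\ i) (link i F) :|: deletion i F|.
Proof.
by move=> iS sF; rewrite (card_deletion_link i) deletion_up_shadow (link_up_shadow iS sF).
Qed.

(** * The complementary pair and the compression argument *)

Lemma initial_sections_complement S k F A B : F \subset layer S k ->
    (forall i, i \in S -> initial (layer (S :\ i) k) (deletion i F)) ->
    (forall i, i \in S -> initial (layer (S :\ i) k.-1) (link i F)) ->
    A \in F -> B \in layer S k -> B \notin F -> weight A < weight B ->
  B = S :\: A.
Proof.
move=> /subsetP sF iD iL AF /layerP[sBS cB] BF ltAB.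
have [sAS cA] := layerP _ _ _ (sF _ AF).
(* If [A] and [B] agreed at some [i] in [S], the initial section of [F] at [i] would force [B] into
   [F]. *)
apply/setP=> i; rewrite inE; case iS: (i \in S); last first.
  by rewrite andbF; apply: contraFF iS => /(subsetP sBS).
rewrite andbT; case iA: (i \in A); case iB: (i \in B) => //=.
  suff : B :\ i \in link i F by rewrite inE setD1K // (negPf BF) andbF.
  apply: ((iL i iS).2 (A :\ i)).
  - by rewrite inE setD11 setD1K.
  - apply/layerP; rewrite setSD //; split=> //.
    by rewrite -cB (cardsD1 i B) iB.
  by have := ltAB; rewrite (weightD1 iA) (weightD1 iB) ltn_add2l => /ltnW.
suff : B \in deletion i F by rewrite inE (negPf BF).
apply: ((iD i iS).2 A _ _ _ (ltnW ltAB)); first by rewrite inE AF iA.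
by apply/layerP; rewrite subsetD1 sBS iB.
Qed.

(** A new shadow member is [B] plus a point [x] of [A]. It also covers a member of [F]: [A] itself
    if [B] is a singleton, and otherwise a set obtained by dropping a suitable point of [B]. *)
Lemma initial_sections_swap S k F A B : F \subset layer S k ->
    (forall i, i \in S -> initial (layer (S :\ i) k) (deletion i F)) ->
    (forall i, i \in S -> initial (layer (S :\ i) k.-1) (link i F)) ->
    A \in F -> B \in layer S k -> B \notin F -> weight A < weight B ->
  up_shadow S (B |: (F :\ A)) \subset up_shadow S F.
Proof.
move=> sF iD iL AF Blay BF ltAB.
have compl C : C \in layer S k -> C \notin F -> weight A < weight C -> C = S :\: A.
  by move=> Clay CF ltAC; apply: initial_sections_complement Clay CF ltAC.
have defB := compl B Blay BF ltAB.
have [sBS cB] := layerP _ _ _ Blay.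
have [sAS cA] := layerP _ _ _ (subsetP sF _ AF).
have /weight_ltP[z [zA zB eqlt]] := ltAB.
(* Complementary sets differ at every point of [S], so their first difference [z] is the least
   element of [S]. *)
have zmin j : j \in S -> z <= j.
  move=> jS; rewrite leqNgt; apply/negP=> /eqlt.
  by rewrite defB inE jS andbT; case: (j \in A).
apply/subsetP=> D /up_shadowP[sDS [x xD]].
case/setU1P=> [eqDB|/setD1P[_ DF]]; last by apply/up_shadowP; split=> //; exists x.
have xB : x \notin B by rewrite -eqDB setD11.
have xA : x \in A.
  by apply: contraR xB => xA; rewrite defB inE xA (subsetP sDS).
apply/up_shadowP; split=> //.
case: (set_0Vmem (B :\ z)) => [B0|[y /setD1P[neqyz yB]]].
  have cA1 : #|A :\ x| = 0.
    have := cardsD1 x A; rewrite xA cA -cB (cardsD1 z B) zB B0 cards0.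
    by rewrite !add1n => -[<-].
  exists z; first by move: zB; rewrite -eqDB => /setD1P[].
  suff -> : D :\ z = A by [].
  have neqxz : x != z by apply: contraNneq xB => ->.
  rewrite -(setD1K xD) eqDB -(setD1K zB) B0 -(setD1K xA) (cards0_eq cA1).
  apply/setP=> j; rewrite !inE; case: (eqVneq j x) => [->|_] /=.
    by rewrite neqxz.
  by case: (eqVneq j z).
have yD : y \in D by move: yB; rewrite -eqDB => /setD1P[].
have zDy : z \in D :\ y.
  by rewrite !inE eq_sym neqyz; move: zB; rewrite -eqDB => /setD1P[].
(* As [D :\ y] contains [z], it is heavier than [A]; outside [F] it would have to be [S :\: A], that
   is [B], which contains [y]. *)
exists y => //; apply: contraTT yB => DF.
rewrite defB -(compl (D :\ y)) ?setD11 //.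
  apply/layerP; rewrite (subset_trans (subD1set _ _) sDS); split=> //.
  have := cardsD1 y D; rewrite yD (cardsD1 x D) xD eqDB cB.
  by rewrite !add1n => -[<-].
apply/weight_ltP; exists z; split=> // j ltjz.
have jS : j \notin S by apply: contraL ltjz => /zmin; rewrite -leqNgt.
rewrite (negbTE (contra (subsetP sAS j) jS)).
by rewrite inE (negbTE (contra (subsetP sDS j) jS)) andbF.
Qed.

(** In the link part of the shadow, [up_shadow (S :\ i) L1] and [L0] are both initial, hence nested:
    their union is the larger one, and each is bounded by one member of the corresponding union for
    [F]. *)
Lemma card_up_shadow_glue S k i F L0 L1 : i \in S ->
    (forall l G L, G \subset layer (S :\ i) l -> initial (layer (S :\ i) l) L ->
       #|L| = #|G| -> #|up_shadow (S :\ i) L| <= #|up_shadow (S :\ i) G|) ->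
    F \subset layer S k.+1 ->
    initial (layer (S :\ i) k.+1) L0 -> #|L0| = #|deletion i F| ->
    initial (layer (S :\ i) k) L1 -> #|L1| = #|link i F| ->
  #|up_shadow S (glue i L0 L1)| <= #|up_shadow S F|.
Proof.
move=> iS KK sF i0 c0 i1 c1.
rewrite (card_up_shadow iS sF) (card_up_shadow iS (glue_layer iS i0.1 i1.1)).
rewrite (deletion_glue _ i0.1) (link_glue i0.1 i1.1) leq_add //.
  by apply: (KK k.+1) => //; apply: deletion_layer.
case/orP: (initial_total (initial_up_shadow i1) i0) => [/setUidPr->|/setUidPl->].
  by rewrite c0 subset_leq_card ?subsetUr.
apply: leq_trans (subset_leq_card (subsetUl _ _)).
by apply: (KK k) => //; apply: link_layer.
Qed.

Lemma kruskal_katona S k F L : F \subset layer S k -> initial (layer S k) L ->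
  #|L| = #|F| -> #|up_shadow S L| <= #|up_shadow S F|.
Proof.
have [m cS] := ubnP #|S|; elim: m S cS k F L => // m IHm S cS [|k] F L sF iL cLF.
  have lay0 : layer S 0 = [set set0].
    apply/setP=> A; rewrite !inE cards_eq0.
    by case: eqVneq => [->|]; rewrite ?sub0set ?andbF.
  suff -> : L = F by [].
  have := iL.1; move: sF cLF; rewrite lay0 !subset1.
  by move=> /orP[]/eqP-> cL /orP[]/eqP eqL; move: cL;
    rewrite eqL ?cards0 ?cards1.
pose P G := [&& G \subset layer S k.+1, #|G| == #|F| &
  #|up_shadow S G| <= #|up_shadow S F|].
have PF : P F by rewrite /P sF eqxx leqnn.
(* [G] is an extremal competitor: no family satisfying [P] has a larger total weight. *)
case: (arg_maxnP (@total_weight n) PF) => G /and3P[sG /eqP cG leG] maxG.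
(* Gluing initial segments in place of the sections of [G] preserves [P], and strictly raises the
   total weight unless both sections were already initial. *)
have sec i : i \in S ->
    initial (layer (S :\ i) k.+1) (deletion i G) /\ initial (layer (S :\ i) k) (link i G).
  move=> iS; have sD := deletion_layer i sG; have sL := link_layer i sG.
  have [L0 i0 c0] := initial_exists (subset_leq_card sD).
  have [L1 i1 c1] := initial_exists (subset_leq_card sL).
  have delE := deletion_glue L1 i0.1; have linkE := link_glue i0.1 i1.1.
  have /maxG : P (glue i L0 L1).
    rewrite /P (glue_layer iS i0.1 i1.1) (card_deletion_link i) delE linkE c0 c1.
    rewrite -card_deletion_link cG eqxx /= (leq_trans _ leG) //.
    apply: (card_up_shadow_glue iS _ sG i0 c0 i1 c1) => l H K.
    by apply: IHm; move: cS; rewrite (cardsD1 i S) iS.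
  rewrite /= (total_weight_deletion_link i G).
  rewrite (total_weight_deletion_link i (glue _ _ _)) delE linkE c1 leq_add2r.
  have lt0 := initial_total_weight sD i0 (esym c0).
  have lt1 := initial_total_weight sL i1 (esym c1).
  have [->|/lt0 {}lt0] := eqVneq (deletion i G) L0;
    have [->|/lt1 {}lt1] := eqVneq (link i G) L1 => //.
  - by rewrite leq_add2l leqNgt lt1.
  - by rewrite leq_add2r leqNgt lt0.
  by rewrite leqNgt -addSn leq_add // ltnW.
suff iG : initial (layer S k.+1) G.
  have /eqP -> // : L == G.
  by rewrite eqEcard (initial_sub_card iL iG) ?cLF ?cG /=.
split=> // A B AG Blay leAB; apply/negPn/negP => BG.
have ltAB : weight A < weight B.
  by rewrite ltn_neqAle leAB andbT; apply: contraNneq BG => /weight_inj<-.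
have swap : up_shadow S (B |: (G :\ A)) \subset up_shadow S G.
  by apply: (initial_sections_swap sG _ _ AG Blay BG ltAB) => i /sec[].
have BGA : B \notin G :\ A by rewrite inE (negPf BG) andbF.
(* The exchange also preserves [P], yet it trades [A] for the heavier [B], against the maximality of
   [G]. *)
have /maxG : P (B |: (G :\ A)).
  rewrite /P subUset sub1set Blay (subset_trans (subD1set _ _) sG) /=.
  rewrite cardsU1 BGA -cG (cardsD1 A G) AG eqxx /=.
  exact: leq_trans (subset_leq_card swap) leG.
rewrite /= /total_weight big_setU1 //= [leqRHS](big_setD1 A) //= leq_add2r.
by rewrite leqNgt ltAB.
Qed.

End KruskalKatona.

(** * Weights versus the lexicographic order of strings *)

Section Lexicographic.
Variable n : nat.
Implicit Types (A B : {set 'I_n}) (l : nat).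

Lemma ltxi_cat (p s t : seqlexi nat) :
  ((p ++ s : seqlexi nat) < (p ++ t : seqlexi nat))%O = (s < t)%O.
Proof. by elim: p => //= x p IHp; rewrite ltxi_cons lexx IHp. Qed.

(** The strings share the part before the first difference [i]; there [B] continues with [i], and
    [A], having the same size, must continue with a later element. *)
Lemma weight_lt_string A B : #|A| = #|B| -> weight A < weight B ->
  (string_of_set B < string_of_set A)%O.
Proof.
move=> cAB /weight_ltP[i [iA iB eqlt]].
have splitE : exists s1 s2 : seq 'I_n,
  [/\ enum 'I_n = s1 ++ i :: s2, all (fun j : 'I_n => j < i) s1 &
      all (fun j : 'I_n => i < j) s2].
  have := sorted_pairwise ltn_trans [seq val j | j <- enum 'I_n].
  rewrite val_enum_ord iota_ltn_sorted -val_enum_ord.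
  case/splitPr: (mem_enum 'I_n i : i \in enum 'I_n) => s1 s2.
  rewrite map_cat pairwise_cat /= => /esym/and4P[/allrelP r12 _ /allP r2 _].
  exists s1, s2; split=> //; apply/allP=> j js; last exact: r2 (map_f val js).
  by apply: r12; rewrite ?map_f ?mem_head.
have [s1 [s2 [eqs /allP lt1 /allP lt2]]] := splitE.
have enE (C : {set 'I_n}) : enum C = [seq j <- enum 'I_n | j \in C] by rewrite enumT.
have eA := enE A; have eB := enE B; rewrite eqs !filter_cat /= (negPf iA) iB in eA eB.
have eq1 : [seq j <- s1 | j \in A] = [seq j <- s1 | j \in B].
  by apply: eq_in_filter => j /lt1; apply: eqlt.
rewrite /string_of_set eA eB eq1 !map_cat ltxi_cat /=.
move: cAB; rewrite !cardE eA eB eq1 !size_cat /= => /addnI.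
case eq2: [seq j <- s2 | j \in A] => [|j t] //= _.
have ltij : i < j.
  by apply: lt2; have := mem_head j t; rewrite -eq2 mem_filter => /andP[].
by rewrite ltxi_cons !leEnat ltnW //= leqNgt ltij.
Qed.

Lemma lex_le_weight A B : #|A| = #|B| -> lex_le A B = (weight B <= weight A).
Proof.
move=> cAB; rewrite /lex_le; case: (ltngtP (weight A) (weight B)) => [lt|lt|/weight_inj->].
- by rewrite lt_geF // weight_lt_string.
- by rewrite ltW // weight_lt_string.
- by rewrite lexx.
Qed.

Lemma mem_lex_subsets l A : (A \in lex_subsets n l) = (A \in layer setT l).
Proof. by rewrite mem_sort mem_enum !inE subsetT. Qed.

Lemma lex_subsets_uniq l : uniq (lex_subsets n l).
Proof. by rewrite sort_uniq enum_uniq. Qed.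

Lemma layerT l : layer setT l = [set A : {set 'I_n} | #|A| == l].
Proof. by apply/setP=> A; rewrite !inE subsetT. Qed.

Lemma size_lex_subsets l : size (lex_subsets n l) = #|layer [set: 'I_n] l|.
Proof. by rewrite size_sort -cardE layerT. Qed.

(** On a layer the sorted list runs through decreasing weights, so a heavier set has a smaller index
    and is taken first. *)
Lemma initial_Omega (N : 'rV[nat]_n) l : initial (layer setT l) (Omega N l).
Proof.
split; first by apply/subsetP=> A; rewrite inE => /mem_take; rewrite mem_lex_subsets.
move=> A B + + leAB; rewrite -mem_lex_subsets => + Bs; rewrite !inE => AO.
have As := mem_take AO; move: AO; rewrite !in_take // => /(leq_ltn_trans _)-> //.
rewrite leqNgt; apply/negP=> lt.
have tr : transitive (@lex_le n) by move=> C D E; apply: le_trans.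
have srt : sorted (@lex_le n) (lex_subsets n l).
  by apply: sort_sorted => C D; apply: le_total.
have := sorted_ltn_index tr srt _ _ As Bs lt.
move: As Bs; rewrite !mem_lex_subsets => /layerP[_ cA] /layerP[_ cB].
rewrite lex_le_weight ?cA ?cB // => leBA.
have eqAB : A = B by apply: weight_inj; apply/eqP; rewrite eqn_leq leAB.
by rewrite eqAB ltnn in lt.
Qed.

Lemma card_Omega (N : 'rV[nat]_n) l :
  #|Omega N l| = minn (omega_size N l) #|layer [set: 'I_n] l|.
Proof.
by rewrite cardsE (card_uniqP _) ?take_uniq ?lex_subsets_uniq // size_take_min
  size_lex_subsets.
Qed.

End Lexicographic.

(** * Counting permutations by their sets of failed components *)

Section Counting.

(** List each set followed by its complement and match the two lists position by position. *)
Lemma perm_imset_card_eq (T : finType) (A B : {set T}) : #|A| = #|B| ->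
  exists p : {perm T}, [set p x | x in A] = B.
Proof.
move=> cAB; pose s (C : {set T}) := enum C ++ enum (~: C).
have mem_s C x : x \in s C by rewrite mem_cat !mem_enum inE orbN.
have size_s C : size (s C) = #|T| by rewrite size_cat -!cardE cardsC.
have uniq_s C : uniq (s C).
  rewrite cat_uniq !enum_uniq andbT /=; apply/hasPn=> x.
  by rewrite !mem_enum inE.
(* The default [x] is never returned: both lists have length [#|T|]. *)
pose f x := nth x (s B) (index x (s A)).
have idx x : index x (s A) < size (s B) by rewrite size_s -(size_s A) index_mem.
have inj_f : injective f.
  move=> x y; rewrite /f (set_nth_default y) // => /eqP; rewrite nth_uniq // => /eqP.
  by apply: index_inj.
exists (perm inj_f); apply/eqP; rewrite eqEcard card_imset; last exact: perm_inj.
rewrite cAB leqnn andbT; apply/subsetP=> _ /imsetP[x xA ->]; rewrite permE /f.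
have ltA : index x (enum A) < #|A| by rewrite cardE index_mem mem_enum.
rewrite index_cat mem_enum xA nth_cat -cardE -cAB ltA -mem_enum mem_nth //.
by rewrite -cardE -cAB.
Qed.

Variable n : nat.
Implicit Types (A B : {set 'I_n}) (s : 'S_n) (l : nat).

Definition first_failed s l : {set 'I_n} := [set s j | j : 'I_n & j < l].

Lemma card_first_failed s l : l <= n -> #|first_failed s l| = l.
Proof.
move=> leln; rewrite card_imset; last exact: perm_inj.
rewrite -sum1_card (eq_bigl (fun j : 'I_n => j < l)) => [|j]; last by rewrite inE.
by rewrite -(big_ord_widen n (fun=> 1)) // sum_nat_const card_ord muln1.
Qed.

Lemma setC_first_failed s l : [set s j | j in 'I_n & l <= j] = ~: first_failed s l.
Proof.
apply/setP=> x; rewrite inE; apply/imsetP/idP => [[j + ->]|xF].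
  rewrite !inE /= => lej; apply/imsetP=> -[k]; rewrite inE => ltk /perm_inj eqjk.
  by rewrite leqNgt eqjk ltk in lej.
exists (s^-1 x)%g; rewrite ?permKV // inE /= leqNgt; apply: contra xF => lt.
by apply/imsetP; exists (s^-1 x)%g; rewrite ?permKV ?inE.
Qed.

(** Multiplying on the right by a permutation that carries [A] to [B] maps one fiber injectively
    into the other. *)
Lemma leq_card_first_failed A B l : #|A| = #|B| ->
  #|[set s | first_failed s l == A]| <= #|[set s | first_failed s l == B]|.
Proof.
case/perm_imset_card_eq=> p <-.
rewrite -(card_imset _ (mulIg p)); apply/subset_leq_card/subsetP=> _ /imsetP[s + ->].
rewrite !inE => /eqP<-; apply/eqP; rewrite -imset_comp.
by apply: eq_imset => j; rewrite permM.
Qed.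

Lemma card_layerT l : #|layer [set: 'I_n] l| = 'C(n, l).
Proof. by rewrite layerT card_draws card_ord. Qed.

(* The symmetric group acts transitively on the [l]-subsets, so all the fibers
   of [first_failed] over them have the same size. *)
Lemma card_first_failed_eq A : let l := #|A| in
  #|[set s : 'S_n | first_failed s l == A]| = l`! * (n - l)`!.
Proof.
move=> l; have leln : l <= n by rewrite -[n]card_ord max_card.
have fiber B : B \in layer setT l ->
    #|[set s | first_failed s l == B]| = #|[set s | first_failed s l == A]|.
  by case/layerP=> _ cB; apply/eqP; rewrite eqn_leq !leq_card_first_failed.
(* After multiplication by ['C(n, l)], the left side adds up all the equal fibers and the right side
   is the order of the symmetric group. *)
apply/eqP; rewrite -(@eqn_pmul2l 'C(n, l)) ?bin_gt0 // bin_fact //.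
rewrite -card_layerT -sum_nat_const -(eq_bigr _ fiber) -card_Sn -sum1_card.
rewrite (partition_big (fun s => first_failed s l) (mem (layer setT l))) /=.
  apply/eqP/eq_bigr => B _; rewrite -sum1_card.
  by apply: eq_bigl => s; rewrite inE.
by move=> s _; apply/layerP; rewrite subsetT card_first_failed.
Qed.

(** The cut sets of size [l]: [A] consists of failed components, so [phi] is evaluated at its
    complement. *)
Definition down_layer (phi : {set 'I_n} -> bool) l : {set {set 'I_n}} :=
  [set A in layer setT l | ~~ phi (~: A)].

(** The permutations with the system down after [l.+1] failures are those with it down after [l],
    together with those whose breakdown index is the ordinal [l]. *)
Lemma sum_breakdown_count (phi : {set 'I_n} -> bool) l :
    structure_function phi -> l <= n ->
  \sum_(i < n | i < l) breakdown_count phi i =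
  #|[set s : 'S_n | ~~ phi (~: first_failed s l)]|.
Proof.
case=> mono _ phiT; elim: l => [|l IHl] leln.
  rewrite big_pred0 //; apply/esym/eqP; rewrite cards_eq0; apply/eqP/setP=> s.
  rewrite !inE; suff -> : first_failed s 0 = set0 by rewrite setC0 phiT.
  by apply/eqP; rewrite -cards_eq0 card_first_failed.
rewrite (bigD1 (Ordinal leln)) //= addnC.
have -> : \sum_(i < n | (i < l.+1) && (i != Ordinal leln)) breakdown_count phi i =
    \sum_(i < n | i < l) breakdown_count phi i.
  by apply: eq_bigl => i; rewrite ltnS [in RHS]ltn_neqAle andbC.
rewrite IHl ?(ltnW leln) //.
rewrite -(cardsID [set s : 'S_n | ~~ phi (~: first_failed s l)]
                  [set s : 'S_n | ~~ phi (~: first_failed s l.+1)]).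
congr (_ + _); apply: eq_card => s; rewrite !inE.
  rewrite andb_idl //; apply: contra => phiS.
  have sub : ~: first_failed s l.+1 \subset ~: first_failed s l.
    by rewrite setCS; apply/imsetS/subsetP=> j; rewrite !inE; apply: ltnW.
  by have := mono _ _ sub; rewrite phiS lt0b.
by rewrite /breakdown_index !setC_first_failed negbK andbC.
Qed.

Lemma sum_breakdown_count_down (phi : {set 'I_n} -> bool) l :
    structure_function phi -> l <= n ->
  \sum_(i < n | i < l) breakdown_count phi i =
  #|down_layer phi l| * (l`! * (n - l)`!).
Proof.
move=> sphi leln; rewrite sum_breakdown_count // -sum1_card.
rewrite (partition_big (fun s => first_failed s l) (mem (down_layer phi l))) /=.
  rewrite -sum_nat_const; apply: eq_bigr => A; rewrite inE => /andP[/layerP[_ cA] phiA].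
  rewrite -cA -card_first_failed_eq -[RHS]sum1_card; apply: eq_bigl => s.
  by rewrite !inE; case: eqP => [->|]; rewrite ?phiA ?andbF.
move=> s; rewrite inE => phis; rewrite inE phis andbT.
by apply/layerP; rewrite subsetT card_first_failed.
Qed.

(** One more failure cannot bring the system up again. *)
Lemma up_shadow_down_layer (phi : {set 'I_n} -> bool) l : structure_function phi ->
  up_shadow setT (down_layer phi l) \subset down_layer phi l.+1.
Proof.
case=> mono _ _; apply/subsetP=> B.
have sD : down_layer phi l \subset layer setT l.
  by apply/subsetP=> A; rewrite inE => /andP[].
move=> BU; rewrite inE (subsetP (up_shadow_layer sD) _ BU) /=.
case/up_shadowP: BU => _ [x xB]; rewrite inE => /andP[_]; apply: contra => phiB.
by have := mono (~: B) (~: (B :\ x)); rewrite setCS subD1set phiB lt0b; apply.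
Qed.

End Counting.

(** * The families [Omega] of a candidate signature *)

Section Omega.
Variables (n : nat) (s : 'rV[rat]_n) (N : 'rV[nat]_n).
Hypothesis NE : forall i : 'I_n, ((N ord0 i)%:R = (n`!)%:R * s ord0 i)%R.

Lemma contains_supersets_signature : is_signature s -> contains_supersets N.
Proof.
case=> phi sphi sE l /andP[l_gt0 ltln] A B AO sAB cB.
have Ncount i : N ord0 i = breakdown_count phi i.
  apply/eqP; rewrite -(eqr_nat rat) NE sE mxE mulrC divfK //.
  by rewrite pnatr_eq0 -lt0n fact_gt0.
(* For a signature the division in [omega_size] is exact, and the quotient does not exceed the
   number of [k]-sets. *)
have cO k : k <= n -> #|Omega N k| = #|down_layer phi k|.
  move=> lekn; rewrite card_Omega /omega_size (eq_bigr _ (fun i _ => Ncount i)).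
  rewrite sum_breakdown_count_down // [_`! * _`!]mulnC mulnK ?muln_gt0 ?fact_gt0 //.
  apply/minn_idPl/subset_leq_card/subsetP=> C.
  by rewrite inE => /andP[].
have leln : l < n by lia.
have iO := initial_Omega N.
apply: (subsetP (initial_sub_card (initial_up_shadow (iO l)) (iO l.+1) _)).
  rewrite (cO l.+1) //; apply: leq_trans (subset_leq_card (up_shadow_down_layer l sphi)).
  apply: kruskal_katona (iO l) _; last by rewrite cO // ltnW.
  by apply/subsetP=> C; rewrite inE => /andP[].
apply/up_shadowP; split; first exact: subsetT.
have [_ cA] := layerP _ _ _ (subsetP (iO l).1 _ AO).
have /subsetPn[x xB xA] : ~~ (B \subset A).
  by apply/negP=> /subset_leq_card; rewrite cA cB ltnn.
exists x => //; suff -> : B :\ x = A by [].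
apply/esym/eqP; rewrite eqEcard subsetD1 sAB xA cA /=.
by have := cardsD1 x B; rewrite xB cB add1n => -[<-].
Qed.

Hypothesis s_prob : probability_vector s.

(** The entries of [N] sum to [n!], so exactly one [n]-set is taken. *)
Lemma setT_Omega : 0 < n -> setT \in Omega N n.
Proof.
move=> n_gt0.
have sumN : \sum_(i < n) N ord0 i = n`!.
  apply/eqP; rewrite -(eqr_nat rat) natr_sum (eq_bigr _ (fun i _ => NE i)).
  by rewrite -mulr_sumr s_prob.2 mulr1.
have cO : #|Omega N n| = 1.
  rewrite card_Omega card_layerT binn /omega_size subnn mul1n.
  by rewrite (eq_bigl predT) ?sumN ?divnn ?fact_gt0 // => i; rewrite ltn_ord.
have /card_gt0P[A AO] : 0 < #|Omega N n| by rewrite cO.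
have [_ cA] := layerP _ _ _ (subsetP (initial_Omega N n).1 _ AO).
suff <- : A = setT by [].
by apply/eqP; rewrite eqEcard subsetT cardsT card_ord cA leqnn.
Qed.

Lemma mem_OmegaU (A : {set 'I_n}) : 0 < #|A| -> (A \in OmegaU N) = (A \in Omega N #|A|).
Proof.
move=> A_gt0; rewrite /OmegaU big_geq_mkord; apply/bigcupP/idP => [[l _ AO]|AO].
  by have [_ ->] := layerP _ _ _ (subsetP (initial_Omega N l).1 _ AO).
have leAn : #|A| < n.+1 by rewrite ltnS -[leqRHS]card_ord max_card.
by exists (Ordinal leAn).
Qed.

End Omega.

Theorem mainTheorem2 (n : nat) (s : 'rV[rat]_n) (N : 'rV[nat]_n)
  (s_prob : probability_vector s)
  (NE : forall i : 'I_n, ((N ord0 i)%:R = (n`!)%:R * s ord0 i)%R) :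
  ~ contains_supersets N ->
  [/\ ~ is_signature s,
      ~ simplicial_complex (OmegaU N)
    & ~ simplicial_complex (complements (OmegaU N))].
Proof.
move=> notsup; split; first by move/(contains_supersets_signature NE).
  (* Closure under nonempty subsets, applied to [setT], would put every nonempty set into
     [OmegaU N]. *)
  move=> simp; apply: notsup => l /andP[l_gt0 ltln] A B _ _ cB.
  have n_gt0 : 0 < n by lia.
  rewrite -cB -mem_OmegaU ?cB //; apply: (simp setT) => //.
    by rewrite mem_OmegaU cardsT card_ord // (setT_Omega NE s_prob).
  by rewrite -card_gt0 cB.
move=> simp; apply: notsup => l /andP[l_gt0 ltln] A B AO sAB cB.
have n_gt0 : 0 < n by lia.
(* Closure gives [~: B] from [~: A] only when [~: B] is nonempty; for [B = setT] the membership is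
   [setT_Omega]. *)
have [BT|neqBT] := eqVneq B setT.
  have <- : n = l.+1 by rewrite -cB BT cardsT card_ord.
  by rewrite BT (setT_Omega NE s_prob).
rewrite -cB -mem_OmegaU ?cB //.
have [_ cA] := layerP _ _ _ (subsetP (initial_Omega N l).1 _ AO).
have : ~: B \in complements (OmegaU N).
  apply: (simp (~: A)); first by rewrite imset_f // mem_OmegaU cA.
    by rewrite setCS.
  by apply: contra neqBT; rewrite -subset0 -setCT setCS subTset.
by case/imsetP=> C CO /setC_inj->.
Qed.
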